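(* Let $d_v,d_c\ge 2$ and $\ell\ge 0$ be integers. There exists a constant $\gamma=\gamma(d_v,d_c,\ell)>0$ such that the following holds, both for decoders with permanently missing connections and for decoders with transiently missing connections. For the $(d_v,d_c)$-regular LDPC ensemble of length $n$, let $Z$ be the number of incorrect values held among all $n d_v$ edges at the end of the $\ell$th decoding iteration, and let $q$ be the expected number of incorrect values held along an edge at the end of the $\ell$th iteration when the neighborhood of depth $2\ell$ of this edge is cycle-free, the expectations being over the choice of code, the channel noise and the missing connections. Then for any $\varepsilon>0$ and any $n>\frac{2\gamma}{\varepsilon}$, $$\big|E[Z]-n d_v q\big|<n d_v\varepsilon/2 .$$
   Context: Ensemble. The $(d_v,d_c)$-regular LDPC ensemble of length $n$ (with $d_c\mid n d_v$) is the random bipartite (Tanner) multigraph with $n$ variable nodes having $d_v$ sockets each and $n d_v/d_c$ check nodes having $d_c$ sockets each, in which the $n d_v$ variable sockets are matched to the $n d_v$ check sockets by a uniformly random permutation. Code symbols take values in $\{\pm1\}$. Channel. The all-one codeword is transmitted over a binary memoryless symmetric channel (for example a BSC with outputs in $\{\pm 1\}$ or a BEC with outputs in $\{\pm1,?\}$), so that the channel values received at the $n$ variable nodes are i.i.d. Message-passing decoder. In iteration $0$ each variable node forms, for each of its edges, a message that is a function of its received channel value. In each iteration $t\ge 1$, the variable-to-check messages formed in iteration $t-1$ are sent along the edges; each check node computes for each of its edges a message that is a fixed function of the messages received on its other $d_c-1$ edges and sends it; then each variable node computes for each of its edges a message that is a fixed function of its channel value and the check-to-variable messages received on its other $d_v-1$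 edges. Whenever a connection (edge) is missing, any message sent along it, in either direction, is received as the erasure symbol ''$?$'', which belongs to the message alphabet. Missing connections. Let $\alpha\in[0,1]$. Permanently missing: before decoding starts, each edge is removed independently with probability $\alpha$ and stays missing in all iterations. Transiently missing: in each decoding iteration, each edge is missing independently with probability $\alpha$, independently over edges and iterations. Missing-connection randomness is independent of the graph and the channel. The value held on an edge at the end of iteration $\ell$ is the message computed for this edge by its variable node in iteration $\ell$; it is incorrect if it does not represent the transmitted symbol $+1$ (an erasure counts as incorrect). For an edge $\vec e=(v,c)$ from a variable node $v$ to a check node $c$, its neighborhood of depth $2\ell$ is the subgraph consisting of all nodes and edges on non-backtracking paths of length at most $2\ell$ starting at $v$ whose first edge is not $\vec e$; it is cycle-free if it is a tree (all its nodes reached are distinct). Thus $q$ is the probability that the value held on $\vec e$ at the end of iteration $\ell$ is incorrect, given that its depth-$2\ell$ neighborhood is cycle-free (this does not depend on $n$). *)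

(* Defs.v *)
From HB Require Import structures.
From mathcomp Require Import all_boot all_order all_algebra.
From mathcomp Require Import all_classical all_reals all_analysis.

Set Implicit Arguments.
Unset Strict Implicit.
Unset Printing Implicit Defensive.

Import Order.TTheory GRing.Theory Num.Theory.
Local Open Scope classical_set_scope.
Local Open Scope ring_scope.

(* A socket is a pair (node, index of the socket at that node).  An edge is
   identified with its variable socket. *)
Definition edge (n dv : nat) : finType := ('I_n * 'I_dv)%type.

Definition nchecks (n dv dc : nat) : nat := (n * dv %/ dc)%N.

Definition check_socket (n dv dc : nat) : finType :=
  ('I_(nchecks n dv dc) * 'I_dc)%type.

Definition matching (n dv dc : nat) := {ffun edge n dv -> check_socket n dv dc}.

(* When dc divides n * dv there are as many check sockets as variable sockets,
   so the injective maps are exactly the (n * dv)`! perfect matchings. *)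
Definition ensemble (n dv dc : nat) : {set matching n dv dc} :=
  [set s : matching n dv dc | injectiveb s]%SET.

Section Graph.
Variables (n dv dc : nat) (s : matching n dv dc).
Implicit Types (e f : edge n dv) (p q : seq (edge n dv)).

(* The default value e is never used when s is a bijection. *)
Definition edge_at e (x : check_socket n dv dc) : edge n dv :=
  odflt e [pick f | s f == x].

Definition node : Type := ('I_n + 'I_(nchecks n dv dc))%type.

Definition endpoint (var_side : bool) e : node :=
  if var_side then inl e.1 else inr (s e).1.

(* p is the edge sequence of a non-backtracking path that starts at the given
   side of e and whose first edge is not e.  Parallel edges are distinct edges,
   so going forth along one and back along the other is not backtracking. *)
Fixpoint nb_path (var_side : bool) e p : bool :=
  if p is f :: p' then
    [&& endpoint var_side f == endpoint var_side e, f != e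
      & nb_path (~~ var_side) f p']
  else true.

(* Node where a path leaving the variable node of e ends: after an even number
   of steps the current side is the variable side. *)
Definition path_end e p : node := endpoint (~~ odd (size p)) (last e p).

(* The depth-2l neighborhood of e is a tree: distinct non-backtracking paths
   (the empty one included) reach distinct nodes. *)
Definition cycle_free (l : nat) e : Prop :=
  forall p q, (size p <= 2 * l)%N -> (size q <= 2 * l)%N ->
    nb_path true e p -> nb_path true e q ->
    path_end e p = path_end e q -> p = q.

End Graph.

(* Code symbols: true stands for +1, false for -1; opp_out is the sign change
   on channel outputs (it fixes an erasure). *)
Record bms_channel d (O : measurableType d) (R : realType) := BMSChannel {
  law : bool -> probability O R;
  opp_out : O -> O;
  measurable_opp_out : measurable_fun [set: O] opp_out;
  opp_outK : involutive opp_out;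
  law_sym : forall (x : bool) (A : set O), measurable A ->
    law (~~ x) A = law x (opp_out @^-1` A) }.

Section Iid.
Context d (O : measurableType d) (R : realType) (P : probability O R).

Definition cons_pair (n : nat) (xt : O * n.-tuple O) : n.+1.-tuple O :=
  [tuple of xt.1 :: xt.2].

Lemma measurable_cons_pair (n : nat) :
  measurable_fun [set: O * n.-tuple O] (@cons_pair n).
Proof. exact: (measurable_cons measurable_fst measurable_snd). Qed.

HB.instance Definition _ (n : nat) :=
  isMeasurableFun.Build _ _ _ _ (@cons_pair n) (@measurable_cons_pair n).

(* The n-fold product of P. *)
Fixpoint iid (n : nat) : probability (n.-tuple O) R :=
  match n with
  | 0 => \d_([tuple] : 0.-tuple O)
  | n'.+1 => distribution (P \x iid n')%E (@cons_pair n')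
  end.

End Iid.

(* plus_one is the set of messages representing the symbol +1.  check_upd and
   var_upd receive the messages of the other sockets in socket order; they are
   not required to be symmetric. *)
Record decoder d (O : measurableType d) d' (M : measurableType d')
    (dv dc : nat) := Decoder {
  erasure : M;
  plus_one : set M;
  init : O -> M;
  check_upd : dc.-1.-tuple M -> M;
  var_upd : O * dv.-1.-tuple M -> M;
  erasure_incorrect : ~ plus_one erasure;
  measurable_plus_one : measurable plus_one;
  measurable_init : measurable_fun [set: O] init;
  measurable_check_upd : measurable_fun [set: dc.-1.-tuple M] check_upd;
  measurable_var_upd : measurable_fun [set: O * dv.-1.-tuple M] var_upd }.

Section Decoding.
Context d (O : measurableType d) d' (M : measurableType d').
Variables (n dv dc : nat) (D : decoder O M dv dc) (s : matching n dv dc).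
(* miss t e: the edge e is missing in iteration t *)
Variables (miss : nat -> edge n dv -> bool) (y : n.-tuple O).

Definition receive (t : nat) (e : edge n dv) (x : M) : M :=
  if miss t e then erasure D else x.

(* Message sent by the check node of e along e in iteration t, where prev gives
   the variable-to-check messages formed in iteration t - 1. *)
Definition check_msg (t : nat) (prev : edge n dv -> M) (e : edge n dv) : M :=
  let c := s e in
  check_upd D [tuple (let f := edge_at s e (c.1, lift c.2 j) in
                      receive t f (prev f)) | j < dc.-1].

(* Message formed for e by its variable node in iteration t. *)
Fixpoint var_msg (t : nat) (e : edge n dv) : M :=
  if t is t'.+1 then
    var_upd D (tnth y e.1,
      [tuple (let f := (e.1, lift e.2 i) in
              receive t f (check_msg t (var_msg t') f)) | i < dv.-1])
  else init D (tnth y e.1).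

Definition incorrect (l : nat) (e : edge n dv) : Prop :=
  ~ plus_one D (var_msg l e).

Definition num_incorrect (l : nat) : nat :=
  #|[set e : edge n dv | `[< incorrect l e >]]%SET|.

End Decoding.

Variant missing_mode := Permanent | Transient.

(* Mean of F A over a random subset A of U containing each element
   independently with probability alpha. *)
Definition bernoulli_mean (R : realType) (U : finType) (alpha : R)
    (F : {set U} -> R) : R :=
  \sum_(A : {set U}) alpha ^+ #|A| * (1 - alpha) ^+ #|(~: A)%SET| * F A.

(* Mean of F miss over the pattern of missing connections in iterations
   0, ..., l (no message is sent in iteration 0). *)
Definition missing_mean (R : realType) (mode : missing_mode) (n dv l : nat)
    (alpha : R) (F : (nat -> edge n dv -> bool) -> R) : R :=
  match mode with
  | Permanent =>
      bernoulli_mean alpha (fun A : {set edge n dv} => F (fun _ e => e \in A))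
  | Transient =>
      bernoulli_mean alpha (fun A : {set 'I_l.+1 * edge n dv} =>
        F (fun t e => (inord t, e) \in A))
  end.

Section Expectation.
Context (R : realType) d (O : measurableType d) d' (M : measurableType d').
Variables (n dv dc l : nat) (mode : missing_mode) (alpha : R).
Variables (W : bms_channel O R) (D : decoder O M dv dc).

(* Expectation over the uniform matching, the independent missing connections
   and the channel values when the all-(+1) codeword is transmitted. *)
Definition Ex
    (F : matching n dv dc -> (nat -> edge n dv -> bool) -> n.-tuple O -> R)
    : R :=
  #|ensemble n dv dc|%:R^-1 *
  \sum_(s in ensemble n dv dc)
    missing_mean mode l alpha
      (fun miss => \int[iid (law W true) n]_y F s miss y).

Definition expected_incorrect : R :=
  Ex (fun s miss y => (num_incorrect D s miss y l)%:R).

Definition prob_cycle_free (e : edge n dv) : R :=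
  Ex (fun s _ _ => (`[< cycle_free s l e >])%:R).

(* Conditional probability, given that the depth-2l neighborhood of e is
   cycle-free, that the value held on e at the end of iteration l is
   incorrect. *)
Definition cond_incorrect (e : edge n dv) : R :=
  Ex (fun s miss y =>
        (`[< incorrect D s miss y l e /\ cycle_free s l e >])%:R)
  / prob_cycle_free e.

End Expectation.

(* Main.v *)
(* Write E[Z] as the sum over all edges of the probability that the value held
   on the edge is incorrect.  If the neighborhood of an edge is a tree, the
   value is computed from channel values at distinct variable nodes and from
   the states of distinct edges, each of them received from in one iteration
   only; so, whatever the matching, it has the law of the value computed on one
   fixed tree with independent labels, and conditioning on tree-likeness gives
   the same q everywhere.  Hence |E[Z] - n dv q| is at most n dv times the
   probability that a neighborhood is not a tree, and it remains to see that
   this probability is O(1/n).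

   For this, take the first depth at which two non-backtracking paths p f and r
   from the edge meet.  Then f occurs neither in p nor in r.  Exchanging the
   check sockets of f and of any edge f' outside p and r gives another matching,
   from which f and f' are recovered by walking along the same socket numbers
   as p and r.  So pairs of a matching with such a collision and one of about
   n dv edges f' inject into the ensemble times a bounded set. *)
From HB Require Import structures.
Require Import Defs.
From mathcomp Require Import all_boot all_order all_algebra.
From mathcomp Require Import perm.
From mathcomp Require Import all_classical all_reals all_analysis.
From mathcomp Require Import unstable measurable_realfun.
From mathcomp Require Import ring lra zify.
Set Implicit Arguments.
Unset Strict Implicit.
Unset Printing Implicit Defensive.
Import Order.TTheory GRing.Theory Num.Theory.
Local Open Scope ring_scope.

(** * Neighborhoods with a cycle *)

Section Walks.
Variables (n dv dc : nat).
Hypothesis dvd_dc : (dc %| n * dv)%N.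
Implicit Types (s : matching n dv dc) (e f : edge n dv) (p q : seq (edge n dv)).

Lemma card_check_socket : #|check_socket n dv dc| = #|edge n dv|.
Proof. by rewrite !card_prod !card_ord divnK. Qed.

Lemma edge_atK s e : injective s -> cancel s (edge_at s e).
Proof.
move=> s_inj f; rewrite /edge_at; case: pickP => [g /eqP /s_inj // | /(_ f)].
by rewrite eqxx.
Qed.

Lemma edge_at_matched s e x : injective s -> s (edge_at s e x) = x.
Proof.
move=> s_inj; have [g _ gK] := inj_card_bij s_inj (eq_leq card_check_socket).
by rewrite -[x]gK edge_atK.
Qed.

Lemma nb_path_rcons s b e p f :
  nb_path s b e (rcons p f) =
  [&& nb_path s b e p,
      endpoint s (b (+) odd (size p)) f ==
        endpoint s (b (+) odd (size p)) (last e p) & f != last e p].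
Proof.
elim: p b e => [|g p IHp] b e /=; first by rewrite addbF andbT.
by rewrite IHp addbN addNb -!andbA.
Qed.

Lemma nb_path_catl s b e p q : nb_path s b e (p ++ q) -> nb_path s b e p.
Proof.
by elim: p b e => //= g p IHp b e /and3P[-> -> /IHp].
Qed.

Lemma nb_path_rcons_end s e p f : nb_path s true e (rcons p f) ->
  endpoint s (~~ odd (size p)) f = path_end s e p /\ f != last e p.
Proof. by rewrite nb_path_rcons addTb => /and3P[_ /eqP]. Qed.

Lemma path_end_rcons s e p f :
  path_end s e (rcons p f) = endpoint s (odd (size p)) f.
Proof. by rewrite /path_end size_rcons last_rcons /= negbK. Qed.

Lemma path_end_odd s e p q :
  path_end s e p = path_end s e q -> odd (size p) = odd (size q).
Proof. by rewrite /path_end; case: (odd _); case: (odd _). Qed.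

(** At [k = 2 * l] this is [cycle_free s l e]. Odd depths are included so that the first collision
    can be found by induction on [k], one step at a time. *)
Definition distinct_ends s (k : nat) e : Prop :=
  forall p q, (size p <= k)%N -> (size q <= k)%N ->
    nb_path s true e p -> nb_path s true e q ->
    path_end s e p = path_end s e q -> p = q.

(** If [p] and [r] have the same parity, they end at the same endpoint of [f] and so coincide.
    Otherwise [r] followed by [f] ends where [p] does and still has length at most [k], so it equals
    [p]; then [f] is the last edge of [p], and [p] followed by [f] backtracks. *)
Lemma last_edge_uniq s k e p r f : distinct_ends s k e -> size p = k ->
  (size r <= k)%N -> nb_path s true e (rcons p f) ->
  nb_path s true e (rcons r f) -> r = p.
Proof.
move=> Dk szp szr nbp nbr.
have [pE pf] := nb_path_rcons_end nbp; have [rE rf] := nb_path_rcons_end nbr.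
have nbp' : nb_path s true e p by move: nbp; rewrite -cats1 => /nb_path_catl.
have nbr' : nb_path s true e r by move: nbr; rewrite -cats1 => /nb_path_catl.
have [odd_rp|odd_rp] := eqVneq (odd (size r)) (odd (size p)).
  by apply: Dk; rewrite ?szp // -pE -rE odd_rp.
have szr' : (size (rcons r f) <= k)%N.
  rewrite size_rcons ltn_neqAle szr andbT.
  by apply: contraNneq odd_rp => ->; rewrite szp.
have rp : rcons r f = p.
  apply: Dk; rewrite ?szp // path_end_rcons -pE; congr endpoint.
  by case: (odd (size r)) odd_rp; case: (odd (size p)).
by move: pf; rewrite -rp last_rcons eqxx.
Qed.

(** One of the two meeting paths has length exactly [k.+1]; its last edge is [f]. By
    [last_edge_uniq], an occurrence of [f] in [p] or [q] can only be preceded by all of [p]: in [p]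
    this is too long, and in [q] it makes the two paths equal. *)
Lemma first_collision s k e : distinct_ends s k e -> ~ distinct_ends s k.+1 e ->
  exists p f q, [/\ size p = k, (size q <= k.+1)%N,
    nb_path s true e (rcons p f), nb_path s true e q &
    [/\ path_end s e q = path_end s e (rcons p f), f \notin p & f \notin q]].
Proof.
move=> Dk NDk1.
have {NDk1} [p [q [szp szq nbp nbq [E neq]]]] : exists p q, [/\ size p = k.+1,
    (size q <= k.+1)%N, nb_path s true e p, nb_path s true e q &
    path_end s e q = path_end s e p /\ q <> p].
  apply: contrapT => H; apply: NDk1 => p q szp szq nbp nbq E.
  apply: contrapT => neq; case: (ltngtP (size p) k.+1) szp => // szp _.
    case: (ltngtP (size q) k.+1) szq => // szq _.
      by apply: neq; apply: Dk.
    by apply: H; exists q, p; split => //; rewrite // ltnW.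
  by apply: H; exists p, q; split => //; split => // qp; apply: neq.
case: (lastP p) szp nbp E neq => // p' f; rewrite size_rcons => -[szp] nbp E neq.
exists p', f, q; split => //; split => //; apply/negP.
  move=> fp; case/splitPr: fp szp nbp {E neq} => r t; rewrite -cat_rcons => szp nbp.
  have rE : r = rcons r f ++ t.
    apply: (last_edge_uniq Dk szp _ nbp).
      by rewrite -szp size_cat size_rcons addSnnS leq_addr.
    by apply: (@nb_path_catl _ _ _ _ (rcons t f)); move: nbp; rewrite rcons_cat.
  move/(congr1 size): rE; rewrite size_cat size_rcons.
  lia.
move=> fq; case/splitPr: fq szq nbq E neq => r t; rewrite -cat_rcons => szq nbq E.
have szr : (size r <= k)%N 
  by rewrite -ltnS (leq_trans _ szq) // size_cat size_rcons leq_addr.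
have rE : r = p' := last_edge_uniq Dk szp szr nbp (nb_path_catl nbq).
case: t szq nbq E => [|x t]; first by rewrite cats0 rE.
rewrite size_cat size_rcons /= rE szp addSn ltnS -[X in (_ <= X)%N]addn0.
by rewrite leq_add2l.
Qed.

(* Word letters: the first component is used to leave a variable node, the
   second one to leave a check node. *)
Definition letter : finType := ('I_dv * 'I_dc)%type.
Implicit Types (a : letter) (w u : seq letter).

Definition step s (b : bool) e a : edge n dv :=
  if b then (e.1, a.1) else edge_at s e ((s e).1, a.2).

Fixpoint walk s (b : bool) e w : seq (edge n dv) :=
  if w is a :: w' then step s b e a :: walk s (~~ b) (step s b e a) w' else [::].

(** The letter that leads to [f] from either of its endpoints. *)
Definition ports s f : letter := (f.2, (s f).2).

Lemma size_walk s b e w : size (walk s b e w) = size w.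
Proof. by elim: w b e => //= a w IHw b e; rewrite IHw. Qed.

Lemma step_ports s b e f : injective s -> endpoint s b f = endpoint s b e ->
  step s b e (ports s f) = f.
Proof.
move=> s_inj; case: b => -[E] /=; first by rewrite -E -surjective_pairing.
by rewrite -E -surjective_pairing edge_atK.
Qed.

(** Paths are thus coded by words over an alphabet whose size does not depend on [n], which allows a
    union bound over words. *)
Lemma walk_ports s b e p : injective s -> nb_path s b e p ->
  walk s b e (map (ports s) p) = p.
Proof.
move=> s_inj; elim: p b e => //= f p IHp b e /and3P[/eqP E _ nbp].
by rewrite step_ports // IHp.
Qed.

(** A walk consults the matching only on its own edges and, when it starts on the check side, on
    [e]. *)
Lemma eq_walk s s' b e w : injective s -> injective s' ->
  b || (s e == s' e) -> {in walk s b e w, s =1 s'} ->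
  walk s' b e w = walk s b e w.
Proof.
move=> s_inj s'_inj; elim: w b e => //= a w IHw b e be ss'.
have stepE : step s' b e a = step s b e a.
  case: b be ss' => //= /eqP se ss'.
  have := ss' _ (mem_head _ _); rewrite /step /= edge_at_matched // => E.
  by rewrite -se E edge_atK // -E.
rewrite stepE IHw // => [|f fw]; last by rewrite ss' // inE fw orbT.
by rewrite ss' ?inE ?eqxx ?orbT.
Qed.

Definition next s e u a := step s (~~ odd (size u)) (last e (walk s true e u)) a.

(* The walk u a leaves its last edge f, new to u and w, at the end of w. *)
Definition collision e u a w s : bool :=
  [&& odd (size w) == ~~ odd (size u),
      path_end s e (walk s true e w) ==
        endpoint s (odd (size u)) (next s e u a),
      next s e u a \notin walk s true e u & next s e u a \notin walk s true e w].

Lemma collisionP s k e : injective s -> distinct_ends s k e ->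
  ~ distinct_ends s k.+1 e ->
  exists (u : k.-tuple letter) a (w : k.+1.-bseq letter), collision e u a w s.
Proof.
move=> s_inj Dk NDk; have [p [f [q [szp szq nbp nbq]]]] := first_collision Dk NDk.
rewrite path_end_rcons => -[E fp fq].
have nbp' : nb_path s true e p by move: nbp; rewrite -cats1 => /nb_path_catl.
have szu : size (map (ports s) p) == k by rewrite size_map szp.
have szw : (size (map (ports s) q) <= k.+1)%N by rewrite size_map.
exists (Tuple szu), (ports s f), (Bseq szw).
have oddq : odd (size q) = ~~ odd (size p).
  rewrite -[RHS]/(odd (size p).+1) -(size_rcons p f).
  by apply: (path_end_odd (s := s) (e := e)); rewrite path_end_rcons.
have fE : next s e (map (ports s) p) (ports s f) = f.
  rewrite /next walk_ports // size_map step_ports //.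
  by have [] := nb_path_rcons_end nbp.
by rewrite /collision /= fE !walk_ports // !size_map oddq E fp fq !eqxx.
Qed.

(** * Switching two check sockets *)

Definition switch s f f' : matching n dv dc := [ffun g => s (tperm f f' g)].

Lemma switch_inj s f f' : injective s -> injective (switch s f f').
Proof. by move=> s_inj g h; rewrite !ffunE => /s_inj /perm_inj. Qed.

Lemma switchK s f f' : switch (switch s f f') f f' = s.
Proof. by apply/ffunP => g; rewrite !ffunE tpermK. Qed.

(* From the switched matching and the two ports of the switched edge f at s,
   one recovers f and its check socket. *)
Definition recover e u a w s' (a' : letter) : edge n dv * check_socket n dv dc :=
  let g := last e (walk s' true e u) in
  let h := last e (walk s' true e w) in
  if ~~ odd (size u) then ((g.1, a.1), ((s' h).1, a'.2))
  else ((h.1, a'.1), ((s' g).1, a.2)).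

Lemma switchE s f f' p : f \notin p -> f' \notin p ->
  {in p, s =1 switch s f f'}.
Proof.
move=> fp f'p g gp; rewrite ffunE tpermD //.
  by apply: contraNneq fp => ->.
by apply: contraNneq f'p => ->.
Qed.

(** The switch changes nothing on the two walks, so they can be replayed. One endpoint of [f] is the
    end of [u], with socket number given by [a]; the other is the end of [w], with socket number
    given by the ports. *)
Lemma recoverP s e u a w f' : injective s -> collision e u a w s ->
  f' \notin walk s true e u -> f' \notin walk s true e w ->
  let f := next s e u a in
  recover e u a w (switch s f f') (ports s f) = (f, s f).
Proof.
move=> s_inj; set f := next s e u a.
case/and4P; rewrite -/f => /eqP oddw /eqP E fu fw f'u f'w /=.
have s'_inj := @switch_inj s f f' s_inj.
have s'u := switchE s fu f'u; have s'w := switchE s fw f'w.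
(* The check node is read off a walk of odd length, whose last edge is never the default [e]; this
   matters because [e] itself may be one of the switched edges. *)
have last_mem v : odd (size v) -> last e (walk s true e v) \in walk s true e v.
  by case: v => //= x v _; rewrite mem_last.
rewrite /recover !(eq_walk s_inj s'_inj) //; case: ifP => oddu.
  have [wodd fE] : odd (size w) /\ f = ((last e (walk s true e u)).1, a.1).
    by rewrite oddw /f /next oddu.
  rewrite -fE -s'w ?last_mem //; congr (_, _).
  move: E; rewrite /path_end size_walk wodd /= (negbTE oddu) => -[->].
  by rewrite -surjective_pairing.
have [uodd wodd] : odd (size u) /\ odd (size w) = false.
  by rewrite oddw oddu (negbFE oddu).
move: E; rewrite /path_end size_walk wodd uodd => -[->].
rewrite -surjective_pairing -s'u ?last_mem //; congr (_, _).
by rewrite /f /next oddu /= edge_at_matched.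
Qed.

(** Double counting of the pairs of a colliding matching and an edge [f'] off both walks: each such
    matching has at least [n * dv - (size u + size w)] choices of [f'], and the pair is determined
    by the switched matching and a letter. *)
Lemma card_collision e u a w :
  (#|[set s in ensemble n dv dc | collision e u a w s]%SET|
     * (n * dv - (size u + size w)) <=
   #|ensemble n dv dc| * #|letter|)%N.
Proof.
pose free s f' := f' \notin walk s true e u ++ walk s true e w.
pose X := [set x : matching n dv dc * edge n dv |
  [&& x.1 \in ensemble n dv dc, collision e u a w x.1 & free x.1 x.2]]%SET.
pose h (x : matching n dv dc * edge n dv) :=
  let f := next x.1 e u a in (switch x.1 f x.2, ports x.1 f).
have h_inj : {in X &, injective h}.
  move=> [s f'] [t g']; rewrite !inE /free !mem_cat !negb_or /=.
  move=> /and3P[/injectiveP s_inj cs /andP[su sw]].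
  move=> /and3P[/injectiveP t_inj ct /andP[tu tw]] E.
  have := recoverP s_inj cs su sw; have := recoverP t_inj ct tu tw.
  rewrite /h /= in E; case: E => E1 Ea Eb /=.
  rewrite {1 2}/ports -Ea -Eb -E1 => -> [fE sfE].
  (* With [f] and [s f] recovered, [f'] is the edge that the switched matching sends to [s f];
     switching back then gives [s]. *)
  have f'E : f' = g'.
    apply: (@switch_inj s (next s e u a) f' s_inj).
    by rewrite {2}E1 !ffunE !tpermR.
  congr (_, _) => //; apply: (can_inj (fun s => @switchK s (next s e u a) f')).
  by rewrite E1 fE f'E.
have leX : (#|X| <= #|ensemble n dv dc| * #|letter|)%N.
  rewrite -(card_in_imset h_inj) -[#|letter|]cardsT -cardsX.
  apply/subset_leq_card/fintype.subsetP => _ /imsetP[[s f'] /[!inE] /and3P[sE _ _] ->].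
  by rewrite /h /= andbT; apply/injectiveP/switch_inj/injectiveP.
apply: leq_trans leX.
have -> : #|X| = (\sum_(s in [set s in ensemble n dv dc | collision e u a w s]%SET)
                  #|[pred f' | free s f']|)%N.
  under eq_bigr do rewrite -sum1_card.
  rewrite pair_big_dep /= -sum1_card; apply: eq_bigl => -[s f'] /=.
  by rewrite !inE /= -andbA.
rewrite -sum_nat_const; apply: leq_sum => s _.
have := cardC (mem (walk s true e u ++ walk s true e w)).
rewrite card_prod !card_ord => <-.
have := card_size (walk s true e u ++ walk s true e w).
rewrite size_cat !size_walk /free.
rewrite [X in _ -> (_ <= X)%N](_ : _ =
  #|predC (mem (walk s true e u ++ walk s true e w))|).
  by move=> ?; rewrite leq_subLR leq_add2r.
by apply: eq_card => f'.
Qed.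

End Walks.

Definition colliding n dv dc k (e : edge n dv) : {set matching n dv dc} :=
  [set s in ensemble n dv dc | ~~ `[< distinct_ends s k e >]]%SET.
Arguments colliding {n dv} dc k e.

(** Either two paths already meet within depth [k], or the first collision occurs at depth [k.+1]
    and is coded by words. *)
Lemma colliding_sub n dv dc k (e : edge n dv) : (dc %| n * dv)%N ->
  colliding dc k.+1 e \subset (colliding dc k e :|: \bigcup_(x : k.-tuple (letter dv dc)
    * letter dv dc * k.+1.-bseq (letter dv dc))
      [set s in ensemble n dv dc | collision e x.1.1 x.1.2 x.2 s])%SET.
Proof.
move=> dvd_dc; apply/fintype.subsetP => s; rewrite !inE.
case/andP=> sE /asboolP NDk1; rewrite sE /=; apply/orP.
have [Dk|] := boolP `[< distinct_ends s k e >]; last by left.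
right; apply/bigcupP.
have [u [a [w col]]] := collisionP dvd_dc (injectiveP _ sE) (asboolW Dk) NDk1.
by exists (u, a, w) => //; rewrite !inE sE.
Qed.

Lemma card_colliding dv dc k : (2 <= dv)%N -> exists c : nat, forall n (e : edge n dv),
  (dc %| n * dv)%N -> (2 * k <= n)%N ->
  (#|colliding dc k e| * n <= c * #|ensemble n dv dc|)%N.
Proof.
move=> dv2; elim: k => [|k [c IHk]].
  exists 0 => n e _ _; rewrite mul0n leqn0 muln_eq0 cards_eq0; apply/orP; left.
  apply/eqP/setP => s; rewrite !inE; apply/negbTE; rewrite negb_and negbK.
  by apply/orP; right; apply/asboolP => -[|? ?] [|? ?].
pose words : finType :=
  (k.-tuple (letter dv dc) * letter dv dc * k.+1.-bseq (letter dv dc))%type.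
exists (c + #|words| * #|letter dv dc|)%N => n e dvd_dc kn.
apply: leq_trans (leq_mul (subset_leq_card (colliding_sub k e dvd_dc)) (leqnn n)) _.
apply: leq_trans (leq_mul (leq_card_setU _ _) (leqnn n)) _.
rewrite mulnDl mulnDl; apply: leq_add; first by apply: IHk => //; lia.
apply: leq_trans (leq_mul (card_big_setU _ _ _) (leqnn n)) _.
rewrite big_distrl /= -mulnA -sum_nat_const; apply: leq_sum => -[[u a] w] _ /=.
rewrite mulnC [leqRHS]mulnC; apply: leq_trans (card_collision dvd_dc e u a w).
(* At least [n] edges are free: [n * dv] is at least [2 * n], and the two words have total length at
   most [2 * k + 1], which is less than [n]. *)
rewrite mulnC leq_mul2l; apply/orP; right.
have := size_bseq w; rewrite size_tuple; move: (size w) => z; nia.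
Qed.

(* The trivial bound 1 covers the lengths n < 4 * l. *)
Lemma card_not_cycle_free dv dc l : (2 <= dv)%N -> exists c : nat,
  forall n (e : edge n dv), (dc %| n * dv)%N ->
  (#|[set s in ensemble n dv dc | ~~ `[< cycle_free s l e >]]%SET| * n
     <= c * #|ensemble n dv dc|)%N.
Proof.
move=> dv2; have [c Hc] := card_colliding dc (2 * l) dv2.
exists (c + 4 * l)%N => n e dvd_dc; rewrite mulnDl.
have [ln|nl] := leqP (2 * (2 * l)) n.
  by apply: leq_trans (Hc n e dvd_dc ln) _; rewrite leq_addr.
rewrite mulnC; apply: leq_trans (leq_addl _ _); apply: leq_mul; first by lia.
by apply/subset_leq_card/fintype.subsetP => s; rewrite inE => /andP[].
Qed.

(** * Marginals of the missing connections and of the channel values *)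

Section Bernoulli.
Variables (R : realType) (alpha : R).

Lemma bernoulli_weightE (U : finType) (A : {set U}) :
  alpha ^+ #|A| * (1 - alpha) ^+ #|(~: A)%SET| =
  \prod_u (if u \in A then alpha else 1 - alpha).
Proof.
rewrite big_if !prodr_const /=; congr (_ * _ ^+ _).
by apply: eq_card => u; rewrite !inE.
Qed.

(** The sum factors over the points of [U]: a point outside the image of [f] contributes
    [alpha + (1 - alpha) = 1], and at [f k] only the choice agreeing with [B] survives. *)
Lemma bernoulli_weight_preimset (K U : finType) (f : K -> U) (B : {set K}) :
  injective f ->
  \sum_(A : {set U} | (f @^-1: A)%SET == B)
     alpha ^+ #|A| * (1 - alpha) ^+ #|(~: A)%SET| =
  alpha ^+ #|B| * (1 - alpha) ^+ #|(~: B)%SET|.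
Proof.
move=> f_inj.
pose c (b : bool) u : R := [forall k, (f k == u) ==> ((k \in B) == b)]%:R.
(* [c b u] tests whether putting [u] inside ([b] true) or outside is compatible with [B]; a set
   whose preimage is not [B] gets a zero factor when the product is expanded. *)
transitivity (\prod_u (alpha * c true u + (1 - alpha) * c false u)).
  rewrite bigA_distr big_mkcond /=; apply: eq_bigr => A _.
  case: eqP => [fAB | /eqP fAB].
    rewrite bernoulli_weightE; apply: eq_bigr => u _.
    case: ifPn => uA; rewrite /c (_ : [forall _, _]) ?mulr1 //;
      apply/forallP => k; apply/implyP => /eqP fk;
      by rewrite -fAB inE fk ?uA ?(negbTE uA).
  have [k kAB] : exists k, (f k \in A) != (k \in B).
    apply/existsP; apply: contraNT fAB; rewrite negb_exists => /forallP H.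
    by apply/eqP/setP => k; rewrite inE; apply/eqP; have := H k; rewrite negbK.
  have c0 b : (k \in B) != b -> c b (f k) = 0.
    move=> kb; rewrite /c; case: forallP => // /(_ k).
    by rewrite eqxx (negbTE kb).
  rewrite (bigD1 (f k)) //=; case: ifPn kAB => fkA kAB;
    by rewrite c0 ?mulr0 ?mul0r // eq_sym.
rewrite bernoulli_weightE (bigID (mem (f @: [set: K])%SET)) /=.
rewrite [X in _ * X]big1 ?mulr1 => [|u uf].
  rewrite big_imset /=; last by move=> ? ? _ _; apply: f_inj.
  apply: eq_big => k; rewrite ?inE // => _.
  have cE b : c b (f k) = ((k \in B) == b)%:R.
    rewrite /c; congr (_%:R); congr nat_of_bool; apply/forallP/idP => [/(_ k)|kB j].
      by rewrite eqxx.
    by apply/implyP => /eqP /f_inj ->.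
  by rewrite !cE; case: ifP => kB /=; rewrite ?mulr1 ?mulr0 ?addr0 ?add0r.
have cE b : c b u = 1.
  rewrite /c (_ : [forall _, _]) //; apply/forallP => k; apply/implyP => /eqP fk.
  by rewrite -fk imset_f ?inE in uf.
by rewrite !cE; ring.
Qed.

Lemma bernoulli_mean_preimset (K U : finType) (f : K -> U) (F : {set K} -> R) :
  injective f ->
  bernoulli_mean alpha (fun A => F (f @^-1: A)%SET) = bernoulli_mean alpha F.
Proof.
move=> f_inj; rewrite /bernoulli_mean.
rewrite (partition_big (fun A : {set U} => (f @^-1: A)%SET) xpredT) //=.
apply: eq_bigr => B _; rewrite -(bernoulli_weight_preimset B f_inj) mulr_suml.
by apply: eq_bigr => A /eqP ->.
Qed.

Lemma bernoulli_weight1 (U : finType) :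
  \sum_(A : {set U}) alpha ^+ #|A| * (1 - alpha) ^+ #|(~: A)%SET| = 1.
Proof.
under eq_bigr do rewrite bernoulli_weightE.
by rewrite -bigA_distr big1 // => u _; rewrite /= addrC subrK.
Qed.

Lemma bernoulli_mean_itv (U : finType) (F : {set U} -> R) : 0 <= alpha <= 1 ->
  (forall A, 0 <= F A <= 1) -> 0 <= bernoulli_mean alpha F <= 1.
Proof.
move=> /andP[a0 a1] F01.
have w0 (A : {set U}) : 0 <= alpha ^+ #|A| * (1 - alpha) ^+ #|(~: A)%SET|.
  by rewrite mulr_ge0 // exprn_ge0 // subr_ge0.
rewrite sumr_ge0 /= => [|A _]; last by rewrite mulr_ge0 //; case/andP: (F01 A).
rewrite -(bernoulli_weight1 U); apply: ler_sum => A _.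
by rewrite ler_piMr //; case/andP: (F01 A).
Qed.

End Bernoulli.

Section MissingMean.
Variables (R : realType) (mode : missing_mode) (n dv l : nat) (alpha : R).
Implicit Types F : (nat -> edge n dv -> bool) -> R.

(** States of distinct edges, each read at a single iteration, are independent in both modes; this
    is why one [q] serves permanently and transiently missing connections. *)
Lemma missing_mean_preimset (K : finType) (time : K -> nat) (f : K -> edge n dv)
    (H : {set K} -> R) : injective f -> (forall k, time k <= l)%N ->
  missing_mean mode l alpha (fun miss => H [set k | miss (time k) (f k)]%SET) =
  bernoulli_mean alpha H.
Proof.
move=> f_inj time_l; rewrite /missing_mean; case: mode.
  rewrite -(bernoulli_mean_preimset alpha H f_inj).
  by congr bernoulli_mean; apply/funext => A; congr H; apply/setP => k; rewrite !inE.
have g_inj : injective (fun k => (inord (time k) : 'I_l.+1, f k)).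
  by move=> j k [_ /f_inj].
rewrite -(bernoulli_mean_preimset alpha H g_inj).
by congr bernoulli_mean; apply/funext => A; congr H; apply/setP => k; rewrite !inE.
Qed.

(** A common form of both modes, from which linearity follows without distinguishing them. *)
Lemma missing_meanE : exists (I : finType) (w : I -> R)
    (miss : I -> nat -> edge n dv -> bool),
  \sum_i w i = 1 /\
  forall F, missing_mean mode l alpha F = \sum_i w i * F (miss i).
Proof.
by case: mode; do 3 eexists; split; try reflexivity; exact: bernoulli_weight1.
Qed.

Lemma missing_mean_sum (I : finType) (F : I -> (nat -> edge n dv -> bool) -> R) :
  missing_mean mode l alpha (fun miss => \sum_i F i miss) =
  \sum_i missing_mean mode l alpha (F i).
Proof.
have [J [w [miss [_ E]]]] := missing_meanE.
rewrite E; under eq_bigr do rewrite mulr_sumr.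
by rewrite exchange_big /=; apply: eq_bigr => i _; rewrite E.
Qed.

Lemma missing_mean_cst (c : R) : @missing_mean R mode n dv l alpha (fun=> c) = c.
Proof.
have [J [w [miss [w1 E]]]] := missing_meanE.
by rewrite E -mulr_suml w1 mul1r.
Qed.

Lemma missing_mean_itv F : 0 <= alpha <= 1 -> (forall miss, 0 <= F miss <= 1) ->
  0 <= missing_mean mode l alpha F <= 1.
Proof.
by move=> a01 F01; rewrite /missing_mean; case: mode; apply: bernoulli_mean_itv.
Qed.

End MissingMean.

Section IidMarginals.
Context d (O : measurableType d) (R : realType) (P : probability O R).
Local Open Scope ereal_scope.
Local Open Scope classical_set_scope.

Definition cylinder n (A : 'I_n -> set O) : set (n.-tuple O) :=
  [set y | forall i, A i (tnth y i)].

Lemma measurable_cylinder n (A : 'I_n -> set O) :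
  (forall i, measurable (A i)) -> measurable (cylinder A).
Proof.
move=> mA; have -> : cylinder A = \big[setI/setT]_(i < n) (@tnth _ O ^~ i @^-1` A i).
  rewrite -bigcap_seq; apply/seteqP; split=> y Ay i; first by move=> _; apply: Ay.
  by apply: Ay => /=; rewrite mem_index_enum.
apply: bigsetI_measurable => i _; rewrite -[_ @^-1` _]setTI.
exact: measurable_tnth.
Qed.

Lemma iid_cylinder n (A : 'I_n -> set O) : (forall i, measurable (A i)) ->
  iid P n (cylinder A) = \prod_(i < n) P (A i).
Proof.
elim: n A => [|n IHn] A mA /=.
  by rewrite big_ord0 diracE mem_set // => -[].
rewrite big_ord_recl -IHn => [|i]; last exact: mA.
rewrite /distribution /pushforward /=.
rewrite (_ : _ @^-1` _ = A ord0 `*` cylinder (fun i => A (lift ord0 i))).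
  rewrite product_measure1E //.
  by apply: measurable_cylinder => i; apply: mA.
apply/seteqP; split=> -[x y] /=.
  move=> Axy; split=> [|i]; first exact: (Axy ord0).
  by have := Axy (lift ord0 i); rewrite /cons_pair tnthS.
case=> Ax Ay i; case: (unliftP ord0 i) => [j ->|-> //].
by rewrite /cons_pair tnthS; apply: Ay.
Qed.

Definition pick_coords n k (f : 'I_k -> 'I_n) (y : n.-tuple O) : k.-tuple O :=
  [tuple tnth y (f j) | j < k].

Lemma measurable_pick_coords n k (f : 'I_k -> 'I_n) :
  measurable_fun [set: n.-tuple O] (pick_coords f).
Proof.
apply/measurable_fun_tnthP => j.
rewrite (_ : _ \o _ = @tnth _ O ^~ (f j)); first exact: measurable_tnth.
by apply/funext => y /=; rewrite tnth_mktuple.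
Qed.

HB.instance Definition _ n k (f : 'I_k -> 'I_n) :=
  isMeasurableFun.Build _ _ _ _ (pick_coords f) (measurable_pick_coords f).

(** Both sides are measures in [B] that agree on cylinders, and cylinders form a generating family
    closed under intersection. *)
Lemma iid_pick_coords n k (f : 'I_k -> 'I_n) (B : set (k.-tuple O)) :
  injective f -> measurable B -> iid P n (pick_coords f @^-1` B) = iid P k B.
Proof.
move=> f_inj; pose cyls := [set C | exists2 A : 'I_k -> set O,
  (forall i, measurable (A i)) & C = cylinder A].
apply: (@measure_unique _ _ _ cyls (fun=> setT) _ _ _ _
  (distribution (iid P n) (pick_coords f)) (iid P k)).
- apply/seteqP; split.
    apply: smallest_sub; first exact: smallest_sigma_algebra.
    rewrite -bigcup_seq => C [i _ [A mA <-]]; apply: sub_sigma_algebra.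
    exists (fun j => if j == i then A else setT) => [j|]; first by case: ifP.
    rewrite setTI; apply/seteqP; split=> y /=.
      by move=> Ay j; case: eqP => [->|].
    by move=> /(_ i); rewrite eqxx.
  apply: smallest_sub; first exact: sigma_algebra_measurable.
  by move=> C [A mA ->]; apply: measurable_cylinder.
- move=> C D [A mA ->] [A' mA' ->]; exists (fun i => A i `&` A' i) => [i|].
    exact: measurableI.
  apply/seteqP; split=> y /= => [[Ay A'y] i|AA'y]; first by split.
  by split=> i; have [] := AA'y i.
- move=> _; exists (fun=> setT) => //.
  by apply/seteqP; split.
- by rewrite bigcup_const.
- move=> C [A mA ->].
  (* Coordinates outside the range of [f] are unconstrained, so they contribute factors 1. *)
  pose A' i := if [pick j | f j == i] is Some j then A j else setT.
  have mA' i : measurable (A' i) by rewrite /A'; case: pickP.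
  have A'f j : A' (f j) = A j.
    rewrite /A'; case: pickP => [j' /eqP /f_inj -> //|/(_ j)]; by rewrite eqxx.
  rewrite [RHS]iid_cylinder //.
  transitivity (iid P n (cylinder A')).
    suff -> : cylinder A' = pick_coords f @^-1` cylinder A by [].
    apply/seteqP; split=> y /= Ay i.
      by rewrite tnth_mktuple -A'f; apply: Ay.
    rewrite /A'; case: pickP => // j /eqP <-.
    by have := Ay j; rewrite tnth_mktuple.
  rewrite iid_cylinder // (bigID (mem (f @: [set: 'I_k])%SET)) /=.
  rewrite [X in _ * X]big1 ?mule1 => [|i fi].
    rewrite big_imset /=; last by move=> ? ? _ _; apply: f_inj.
    by apply: eq_big => j; rewrite ?inE // A'f.
  rewrite /A'; case: pickP => [j /eqP ji|_]; last exact: probability_setT.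
  by rewrite -ji imset_f ?inE in fi.
- move=> _; rewrite [X in X < _](_ : _ = iid P n setT) //.
  by rewrite probability_setT ltry.
Qed.

End IidMarginals.

(** * The computation tree *)

Section ComputationTree.
Variables (dv dc : nat).

(* None is the root; Some (i, j, x) is the position x in the subtree below the
   j-th other socket of the check node at the i-th other socket of the root. *)
Fixpoint var_pos (t : nat) : finType :=
  if t is t'.+1 then option ('I_dv.-1 * 'I_dc.-1 * var_pos t') else unit.

(* inl i is the edge above the i-th check node, inr (i, j, None) the edge below
   it to its j-th child. *)
Fixpoint edge_pos (t : nat) : finType :=
  if t is t'.+1 then ('I_dv.-1 + 'I_dv.-1 * 'I_dc.-1 * option (edge_pos t'))%type
  else void.

(* The only iteration in which the root value depends on the state of the edge. *)
Fixpoint edge_time (t : nat) : edge_pos t -> nat :=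
  if t is t'.+1 then fun x =>
    if x is inr (_, Some x') then edge_time x' else t'.+1
  else fun=> 0%N.

Lemma edge_time_le t (x : edge_pos t) : (edge_time x <= t)%N.
Proof.
elim: t x => [[]|t IHt] [i|[[i j] [x|]]] //=.
by rewrite (leq_trans (IHt x)).
Qed.

Section Messages.
Context d (O : measurableType d) d' (M : measurableType d').
Variable D : decoder O M dv dc.

(** Decoding on an abstract tree: the labels are indexed by positions, with no reference to a
    graph. *)
Fixpoint tree_msg (t : nat) : (var_pos t -> O) -> (edge_pos t -> bool) -> M :=
  match t with
  | 0 => fun x _ => init D (x tt)
  | t'.+1 => fun x miss =>
    var_upd D (x None, [tuple
      (if miss (inl i) then erasure D else check_upd D [tuple
        (if miss (inr (i, j, None)) then erasure D else
           tree_msg (fun v => x (Some (i, j, v)))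
                    (fun z => miss (inr (i, j, Some z)))) | j < dc.-1])
      | i < dv.-1])
  end.

Lemma measurable_mktuple dT (T : measurableType dT) dS (S : measurableType dS)
    n (f : 'I_n -> T -> S) : (forall i, measurable_fun [set: T] (f i)) ->
  measurable_fun [set: T] (fun w => [tuple f i w | i < n]).
Proof.
move=> mf; apply/measurable_fun_tnthP => i.
by rewrite (_ : _ \o _ = f i) //; apply/funext => w /=; rewrite tnth_mktuple.
Qed.

(** Labels are measurable functions on an arbitrary [T], so that the induction hypothesis applies to
    the labels of a subtree. *)
Lemma measurable_tree_msg dT (T : measurableType dT) t (x : var_pos t -> T -> O)
    (miss : edge_pos t -> bool) :
  (forall v, measurable_fun [set: T] (x v)) ->
  measurable_fun [set: T] (fun w => tree_msg (x^~ w) miss).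
Proof.
elim: t x miss => [|t IHt] x miss mx /=.
  by apply: measurableT_comp => //; apply: measurable_init.
apply: measurableT_comp; first exact: measurable_var_upd.
apply: measurable_fun_pair => //; apply: measurable_mktuple => i.
case: (miss (inl i)) => //.
apply: measurableT_comp; first exact: measurable_check_upd.
apply: measurable_mktuple => j; case: (miss _) => //.
by apply: IHt => v; apply: mx.
Qed.

End Messages.

Section Embedding.
Variables (n : nat) (s : matching n dv dc).
Implicit Types (e : edge n dv).

Definition sibling e (i : 'I_dv.-1) : edge n dv := (e.1, lift e.2 i).

Definition child e (i : 'I_dv.-1) (j : 'I_dc.-1) : edge n dv :=
  let f := sibling e i in edge_at s f ((s f).1, lift (s f).2 j).

Fixpoint var_path (t : nat) e : var_pos t -> seq (edge n dv) :=
  if t is t'.+1 then fun x =>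
    if x is Some (i, j, x') then
      sibling e i :: child e i j :: var_path (child e i j) x'
    else [::]
  else fun=> [::].

Fixpoint edge_path (t : nat) e : edge_pos t -> seq (edge n dv) :=
  if t is t'.+1 then fun x =>
    match x with
    | inl i => [:: sibling e i]
    | inr (i, j, x') => sibling e i :: child e i j ::
        (if x' is Some x'' then edge_path (child e i j) x'' else [::])
    end
  else fun=> [::].

Definition var_at t e (x : var_pos t) : 'I_n := (last e (var_path e x)).1.

Definition edge_of t e (x : edge_pos t) : edge n dv := last e (edge_path e x).

(** This unfolding is valid in every graph: cycles only make labels at different positions
    coincide. *)
Lemma var_msg_tree d (O : measurableType d) d' (M : measurableType d')
    (D : decoder O M dv dc) miss (y : n.-tuple O) t e :
  var_msg D s miss y t e =
  tree_msg D (fun x : var_pos t => tnth y (var_at e x))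
             (fun x => miss (edge_time x) (edge_of e x)).
Proof.
elim: t e => //= t IHt e; congr (var_upd D (_, _)).
apply/eq_from_tnth => i; rewrite !tnth_mktuple /receive /check_msg.
case: ifP => // _; congr (check_upd D _).
apply/eq_from_tnth => j; rewrite !tnth_mktuple /receive.
by case: ifP => // _; rewrite IHt.
Qed.

Hypotheses (dvd_dc : (dc %| n * dv)%N) (s_inj : injective s).

Lemma child_matched e i j :
  s (child e i j) = ((s (sibling e i)).1, lift (s (sibling e i)).2 j).
Proof. exact: edge_at_matched. Qed.

Lemma sibling_neq e i : sibling e i != e.
Proof.
apply/eqP => /(congr1 snd) /= E; have := neq_lift e.2 i.
by rewrite E eqxx.
Qed.

Lemma child_neq e i j : child e i j != sibling e i.
Proof.
apply/eqP => /(congr1 s); rewrite child_matched => /(congr1 snd) /= E.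
by have := neq_lift (s (sibling e i)).2 j; rewrite E eqxx.
Qed.

Lemma sibling_inj e : injective (sibling e).
Proof. by move=> i i' /(congr1 snd) /lift_inj. Qed.

Lemma child_inj e i : injective (child e i).
Proof. by move=> j j' /(congr1 s); rewrite !child_matched => /(congr1 snd) /lift_inj. Qed.

Lemma nb_path_child e i j p : nb_path s true (child e i j) p ->
  nb_path s true e (sibling e i :: child e i j :: p).
Proof.
move=> nbp; rewrite /nb_path -/(nb_path s) sibling_neq child_neq /=.
by rewrite child_matched /= !eqxx.
Qed.

Lemma nb_var_path t e (x : var_pos t) : nb_path s true e (var_path e x).
Proof.
elim: t e x => [|t IHt] e // [[[i j] x]|] //.
exact: nb_path_child.
Qed.

Lemma nb_edge_path t e (x : edge_pos t) : nb_path s true e (edge_path e x).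
Proof.
elim: t e x => [|t IHt] e; first by case.
move=> [i|[[i j] x]].
  by rewrite /= eqxx sibling_neq.
by apply: nb_path_child; case: x.
Qed.

Lemma size_var_path t e (x : var_pos t) :
  (size (var_path e x) <= 2 * t)%N /\ odd (size (var_path e x)) = false.
Proof.
elim: t e x => [|t IHt] e // [[[i j] x]|] //=.
by have [szx oddx] := IHt (child e i j) x; rewrite negbK mulnS.
Qed.

Lemma size_edge_path t e (x : edge_pos t) :
  (0 < size (edge_path e x) <= 2 * t)%N.
Proof.
elim: t e x => [|t IHt] e; first by case.
move=> [i|[[i j] [x|]]] /=; rewrite mulnS //.
by have /andP[_ szx] := IHt (child e i j) x.
Qed.

Lemma cons2_inj (T : Type) (x x' y y' : T) p p' :
  [:: x, y & p] = [:: x', y' & p'] -> [/\ x = x', y = y' & p = p'].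
Proof. by case=> -> -> ->. Qed.

Lemma var_path_inj t e : injective (@var_path t e).
Proof.
elim: t e => [|t IHt] e; first by case=> -[].
move=> [[[i j] x]|] [[[i' j'] x']|] //=.
by move=> E; have [/sibling_inj <- /child_inj <- /IHt ->] := cons2_inj E.
Qed.

Lemma edge_path_inj t e : injective (@edge_path t e).
Proof.
elim: t e => [|t IHt] e; first by case.
(* This separates the position of a child edge from the positions below it. *)
have no0 e' (x : edge_pos t) : edge_path e' x <> [::].
  by move=> E; have := size_edge_path e' x; rewrite E.
move=> [i|[[i j] x]] [i'|[[i' j'] x']] //=.
  by move=> /(congr1 (head e)) /sibling_inj ->.
move=> E; have [/sibling_inj <- /child_inj <- {E}E] := cons2_inj E.
by case: x x' E => [x|] [x'|] => [/IHt ->||/esym|] // /no0.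
Qed.

Hypothesis (l : nat) (e : edge n dv).
Hypothesis cf : cycle_free s l e.

Lemma var_at_inj : injective (@var_at l e).
Proof.
move=> x x' E; apply: (@var_path_inj _ e).
have [szx oddx] := size_var_path e x; have [szx' oddx'] := size_var_path e x'.
apply: cf => //; try exact: nb_var_path.
by rewrite /path_end oddx oddx' /=; congr inl.
Qed.

(** Cycle-freeness speaks of end nodes; [last_edge_uniq], applied with the longer of the two paths,
    turns it into a statement on last edges. *)
Lemma edge_of_inj : injective (@edge_of l e).
Proof.
have main x x' : (size (edge_path e x') <= size (edge_path e x))%N ->
    @edge_of l e x = edge_of e x' -> x = x'.
  have := nb_edge_path e x; have := nb_edge_path e x'.
  have := size_edge_path e x; have := size_edge_path e x'.
  rewrite /edge_of => + + + + + E.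
  case/lastP Ex : (edge_path e x) E => [|p f] //.
  case/lastP Ex' : (edge_path e x') => [|p' f'] //.
  rewrite !last_rcons !size_rcons => E /andP[_ szp'] /andP[_ szp]; subst f'.
  move=> nbp' nbp pp'.
  apply: (@edge_path_inj _ e); rewrite Ex Ex'; congr rcons; apply/esym.
  apply: (last_edge_uniq (k := size p) _ _ _ nbp nbp') => // q r szq szr.
  by apply: cf; apply: leq_trans (ltnW szp).
move=> x x' E.
have [/main|/ltnW/main] := leqP (size (edge_path e x')) (size (edge_path e x)).
  exact.
by move=> /(_ (esym E)).
Qed.

End Embedding.
End ComputationTree.

(** * Error probabilities *)

Lemma card_ensemble_gt0 n dv dc : (dc %| n * dv)%N -> (0 < #|ensemble n dv dc|)%N.
Proof.
move=> /card_check_socket cardE.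
by rewrite card_inj_ffuns ffact_gt0 cardE.
Qed.

Section Indicators.
Local Open Scope classical_set_scope.

Lemma Rintegral_asbool d (T : measurableType d) (R : realType)
    (mu : {measure set T -> \bar R}) (A : set T) : measurable A ->
  \int[mu]_y (`[< A y >])%:R = fine (mu A).
Proof.
move=> mA; by rewrite -[in RHS](setIT A) -integral_indic.
Qed.

Lemma fine_probability_itv d (T : measurableType d) (R : realType)
    (P : probability T R) (A : set T) : measurable A -> 0 <= fine (P A) <= 1.
Proof.
move=> mA; rewrite fine_ge0 //= -lee_fin fineK; first exact: probability_le1.
exact: fin_num_measure.
Qed.

End Indicators.

Section ErrorProbability.
Local Open Scope classical_set_scope.
Context (R : realType) d (O : measurableType d) d' (M : measurableType d').
Variables (P : probability O R) (dv dc : nat) (D : decoder O M dv dc).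
Variables (mode : missing_mode) (l : nat) (alpha : R).
Local Notation mean := (missing_mean mode l alpha).

Section FixedMatching.
Variables (n : nat) (s : matching n dv dc).
Implicit Types (e : edge n dv) (miss : nat -> edge n dv -> bool).

Definition error_prob miss e : R :=
  fine (iid P n [set y | incorrect D s miss y l e]).

(** The error event depends only on the channel values at the tree positions, numbered here by
    [enum_val] to bring it into the form of [iid_pick_coords]. *)
Lemma incorrect_pick_coords miss e :
  [set y | incorrect D s miss y l e] =
  pick_coords (fun j => var_at s e (enum_val j : var_pos dv dc l)) @^-1`
    [set y | ~ plus_one D (tree_msg D (fun v => tnth y (enum_rank v))
                (fun x => miss (edge_time x) (edge_of s e x)))].
Proof.
have coordsE y : (fun v => tnth (pick_coords (fun j => var_at s e (enum_val j)) y)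
    (enum_rank v)) = (fun v : var_pos dv dc l => tnth y (var_at s e v)).
  by apply/funext => v; rewrite tnth_mktuple enum_rankK.
by apply/seteqP; split => y; rewrite /incorrect /= var_msg_tree coordsE.
Qed.

Lemma measurable_tree_incorrect (miss : edge_pos dv dc l -> bool) :
  measurable [set y : #|var_pos dv dc l|.-tuple O |
     ~ plus_one D (tree_msg D (fun v => tnth y (enum_rank v)) miss)].
Proof.
apply: measurableC; rewrite -[X in measurable X]setTI.
have mf := @measurable_tree_msg _ _ _ _ _ _ D _ _ _
  (fun v (y : #|var_pos dv dc l|.-tuple O) => tnth y (enum_rank v)) miss
  (fun v => measurable_tnth (enum_rank v)).
exact: (mf measurableT _ (measurable_plus_one D)).
Qed.

Lemma measurable_incorrect miss e :
  measurable [set y | incorrect D s miss y l e].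
Proof.
rewrite incorrect_pick_coords -[X in measurable X]setTI.
by apply: measurable_pick_coords => //; apply: measurable_tree_incorrect.
Qed.

Lemma error_prob_itv miss e : 0 <= error_prob miss e <= 1.
Proof.
by apply: fine_probability_itv; exact: measurable_incorrect.
Qed.

Lemma integral_num_incorrect miss :
  \int[iid P n]_y (num_incorrect D s miss y l)%:R = \sum_e error_prob miss e.
Proof.
pose A e := [set y | incorrect D s miss y l e].
have mA e : measurable (A e) := measurable_incorrect miss e.
rewrite /error_prob sum_fine => [|e _]; last first.
  by apply: fin_num_measure; apply: mA.
congr fine; transitivity (\sum_e \int[iid P n]_y (\1_(A e) y)%:E)%E.
  rewrite -ge0_integral_sum //.
    apply: eq_integral => y _; rewrite sumEFin /num_incorrect -sum1_card.
    rewrite big_mkcond natr_sum /=; congr (_%:E); apply: eq_bigr => e _.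
    rewrite inE indicE -[y \in A e]/(`[< incorrect D s miss y l e >]).
    by case: ifP.
  by move=> e; apply/measurable_EFinP; apply: measurable_indic.
by apply: eq_bigr => e _; rewrite integral_indic // setIT.
Qed.

End FixedMatching.

(** The value of [q] on the abstract tree with independent labels; it involves neither a length, an
    edge nor a mode. *)
Definition tree_error : R :=
  bernoulli_mean alpha (fun A : {set edge_pos dv dc l} =>
    fine (iid P #|var_pos dv dc l|
      [set y | ~ plus_one D (tree_msg D (fun v => tnth y (enum_rank v))
                                        (fun x => x \in A))])).

Lemma mean_error_cycle_free n (s : matching n dv dc) (e : edge n dv) :
  (dc %| n * dv)%N -> injective s -> cycle_free s l e ->
  mean (fun miss => error_prob s miss e) = tree_error.
Proof.
move=> dvd_dc s_inj cf.
rewrite /tree_error -(missing_mean_preimset mode alpha _ (edge_of_inj dvd_dc s_inj cf)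
  (@edge_time_le dv dc l)).
congr missing_mean; apply/funext => miss.
rewrite /error_prob incorrect_pick_coords iid_pick_coords.
- rewrite (_ : (fun x => x \in _) = fun x => miss (edge_time x) (edge_of s e x)) //.
  by apply/funext => x; rewrite inE.
- by apply: inj_comp enum_val_inj; apply: var_at_inj.
- exact: measurable_tree_incorrect.
Qed.

Lemma mean_error_itv n (s : matching n dv dc) e : 0 <= alpha <= 1 ->
  0 <= mean (fun miss => error_prob s miss e) <= 1.
Proof. by move=> a01; apply: missing_mean_itv => // miss; apply: error_prob_itv. Qed.

Lemma tree_error_itv : 0 <= alpha <= 1 -> 0 <= tree_error <= 1.
Proof.
move=> a01; apply: bernoulli_mean_itv => // A.
by apply: fine_probability_itv; apply: measurable_tree_incorrect.
Qed.

End ErrorProbability.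

Section Ensemble.
Local Open Scope classical_set_scope.
Context (R : realType) d (O : measurableType d) d' (M : measurableType d').
Variables (W : bms_channel O R) (dv dc : nat) (D : decoder O M dv dc).
Variables (mode : missing_mode) (l : nat) (alpha : R).
Local Notation P := (law W true).
Local Notation mean s e :=
  (missing_mean mode l alpha (fun miss => error_prob P D l s miss e)).
Local Notation q := (tree_error P D l alpha).

Lemma prob_cycle_freeE n (e : edge n dv) :
  prob_cycle_free dc l mode alpha W e = #|ensemble n dv dc|%:R^-1 *
    \sum_(s in ensemble n dv dc) (`[< cycle_free s l e >])%:R.
Proof.
congr (_ * _); apply: eq_bigr => s _.
rewrite [X in missing_mean _ _ _ X](_ : _ = fun=> (`[< cycle_free s l e >])%:R).
  by rewrite missing_mean_cst.
apply/funext => miss.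
by rewrite Rintegral_cst // [X in fine X]probability_setT mulr1.
Qed.

(** A cycle-free matching contributes [q] to the joint probability and any other contributes 0, so
    the quotient is [q]. *)
Lemma cond_incorrectE n (e : edge n dv) : (dc %| n * dv)%N ->
  0 < prob_cycle_free dc l mode alpha W e ->
  cond_incorrect l mode alpha W D e = q.
Proof.
move=> dvd_dc cf_gt0; have p0 := lt0r_neq0 cf_gt0.
rewrite /cond_incorrect; apply: (mulIf p0); rewrite divfK //.
rewrite prob_cycle_freeE mulrCA mulr_sumr; congr (_ * _).
apply: eq_bigr => s /[!inE] /injectiveP s_inj.
case: asboolP => [cf|ncf]; last first.
  rewrite mulr0 -[RHS](missing_mean_cst mode n dv l alpha).
  congr missing_mean; apply/funext => miss.
  under eq_Rintegral do rewrite asboolF => [|[]] //.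
  by rewrite Rintegral_cst // mul0r.
rewrite mulr1 -(mean_error_cycle_free P D mode alpha dvd_dc s_inj cf).
congr missing_mean; apply/funext => miss.
rewrite Rintegral_asbool.
  congr (fine (iid _ _ _)); apply/seteqP; split=> y /=; last by [].
  by case.
rewrite (_ : (fun _ => _) = [set y | incorrect D s miss y l e]).
  exact: measurable_incorrect.
by apply/seteqP; split=> y /= => [[]|].
Qed.

Lemma expected_incorrectE n :
  expected_incorrect n l mode alpha W D = #|ensemble n dv dc|%:R^-1 *
    \sum_(s in ensemble n dv dc) \sum_e mean s e.
Proof.
congr (_ * _); apply: eq_bigr => s _; rewrite -missing_mean_sum.
by congr missing_mean; apply/funext => miss; rewrite integral_num_incorrect.
Qed.

(** For each matching and edge, the error probability equals [q] when the neighborhood is a tree;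
    otherwise both lie in [0, 1] and differ by at most 1. *)
Lemma expected_incorrect_near n : 0 <= alpha <= 1 -> (dc %| n * dv)%N ->
  `|expected_incorrect n l mode alpha W D - (n * dv)%:R * q| <=
  \sum_(e : edge n dv) #|[set s in ensemble n dv dc | ~~ `[< cycle_free s l e >]]%SET|%:R
     / #|ensemble n dv dc|%:R.
Proof.
move=> a01 dvd_dc.
have N0 : #|ensemble n dv dc|%:R != 0 :> R.
  by rewrite pnatr_eq0 -lt0n card_ensemble_gt0.
have -> : (n * dv)%:R * q =
    #|ensemble n dv dc|%:R^-1 * \sum_(s in ensemble n dv dc) \sum_(e : edge n dv) q.
  rewrite !sumr_const card_prod !card_ord -[(q *+ _) *+ _]mulr_natl mulKf //.
  by rewrite mulr_natl.
rewrite expected_incorrectE -mulrBr -sumrB normrM ger0_norm ?invr_ge0 //.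
under [leRHS]eq_bigr do rewrite mulrC.
rewrite -mulr_sumr ler_wpM2l ?invr_ge0 //.
apply: le_trans (ler_norm_sum _ _ _) _.
under [leRHS]eq_bigr do rewrite -sum1_card natr_sum big_mkcond /=.
under [leRHS]eq_bigr do under eq_bigr do rewrite inE.
rewrite [leRHS]exchange_big /= [leRHS](bigID (mem (ensemble n dv dc))) /= -[leLHS]addr0.
apply: lerD; last by apply: sumr_ge0 => s _; apply: sumr_ge0 => e _; case: ifP.
apply: ler_sum => s sE; rewrite -sumrB; apply: le_trans (ler_norm_sum _ _ _) _.
apply: ler_sum => e _; rewrite sE /=.
have [cf|ncf] := boolP `[< cycle_free s l e >].
  move: sE; rewrite inE => /injectiveP s_inj.
  by rewrite (mean_error_cycle_free _ _ _ _ dvd_dc s_inj (asboolW cf)) subrr normr0.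
have /andP[q0 q1] := tree_error_itv P D l a01.
have /andP[m0 m1] := mean_error_itv P D mode l s e a01.
by rewrite ler_norml; lra.
Qed.

End Ensemble.

(* q is the same for all lengths and edges: it is the conditional probability computed
   at any edge of the ensemble of any length m for which the conditioning event
   has positive probability. *)
Theorem theorem2 (R : realType) (dv dc l : nat) (hdv : (2 <= dv)%N) (hdc : (2 <= dc)%N) :
  exists2 gamma : R, 0 < gamma &
    forall (mode : missing_mode) (alpha : R)
      (d : measure_display) (O : measurableType d)
      (d' : measure_display) (M : measurableType d')
      (W : bms_channel O R) (D : decoder O M dv dc)
      (n m : nat) (e : edge m dv) (eps : R),
      0 <= alpha <= 1 ->
      (dc %| n * dv)%N -> (dc %| m * dv)%N ->
      0 < prob_cycle_free dc l mode alpha W e ->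
      0 < eps -> 2 * gamma / eps < n%:R ->
      `|expected_incorrect n l mode alpha W D
        - (n * dv)%:R * cond_incorrect l mode alpha W D e|
        < (n * dv)%:R * eps / 2.
Proof.
have [c Hc] := card_not_cycle_free dc l hdv.
(* A neighborhood fails to be a tree with probability at most [c / n]; the successor keeps [gamma]
   positive even when [c] is 0. *)
exists c.+1%:R => // mode alpha d O d' M W D n m e eps a01 dvd_n dvd_m cf_gt0 eps0 n_gt.
have n0 : 0 < n%:R :> R.
  by apply: le_lt_trans n_gt; rewrite divr_ge0 ?mulr_ge0 // ltW.
rewrite (cond_incorrectE D dvd_m cf_gt0).
apply: le_lt_trans (expected_incorrect_near W D mode l a01 dvd_n) _.
have N0 : 0 < #|ensemble n dv dc|%:R :> R by rewrite ltr0n card_ensemble_gt0.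
apply: (@le_lt_trans _ _ (\sum_(f : edge n dv) c%:R / n%:R)).
  apply: ler_sum => f _; rewrite ler_pdivrMr // mulrAC ler_pdivlMr //.
  by rewrite -!natrM ler_nat Hc.
rewrite sumr_const card_prod !card_ord -[X in X < _]mulr_natl -mulrA.
rewrite ltr_pM2l; last by rewrite natrM mulr_gt0 // ltr0n (leq_trans _ hdv).
move: n_gt; rewrite !ltr_pdivrMr // -[c.+1%:R]natr1 [eps / 2 * _]mulrAC [_ * eps]mulrC.
by move: (eps * _) => x; lra.
Qed.
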